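(* Let $\mu'=(\mu_1,\mu_2,\mu_3)$ be a probability vector with $\mu_1,\mu_2,\mu_3>0$, $\mu_1+\mu_2+\mu_3=1$, and let $P^{\infty}=\vec{e}\mu'$. Put $$b=\frac{4\mu_1\mu_2\mu_3}{(\mu_1\mu_2+\mu_1\mu_3+\mu_2\mu_3)^2}-1,\qquad m=\min\{\mu_1,\mu_2,\mu_3\},$$ and $$\Lambda=\begin{cases}-\exp\left\{-\dfrac{\pi}{\sqrt{b}}\right\}, & \text{when } \frac{1}{\mu_1},\frac{1}{\mu_2},\frac{1}{\mu_3}\text{ satisfy the triangle inequality},\\[2mm] -\exp\left\{-\sqrt{\dfrac{1-m}{m}}\,\pi\right\}, & \text{otherwise.}\end{cases}$$ Then for every $\lambda<0$ such that the matrix $P=P^{\infty}+\lambda(I-P^{\infty})$ is stochastic, $P$ is embeddable if and only if $\Lambda\leq\lambda<0$.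
   Context: A transition rate matrix is a real square matrix with nonnegative off-diagonal entries and all row sums equal to $0$. A $3\times 3$ stochastic matrix $P$ is embeddable if there is a $3\times 3$ transition rate matrix $Q$ with $P=e^{Q}$. Here $\vec{e}=(1,1,1)'$, $'$ denotes transpose, and $I$ is the $3\times 3$ identity matrix. Three positive numbers $a,b,c$ satisfy the triangle inequality if $a+b>c$, $b+c>a$ and $a+c>b$ (strict inequalities). *)

(* Defs.v *)
From HB Require Import structures.
From mathcomp Require Import all_boot all_order all_algebra.
From mathcomp Require Import all_classical all_reals all_analysis.

Set Implicit Arguments.
Unset Strict Implicit.
Unset Printing Implicit Defensive.

Import Order.TTheory GRing.Theory Num.Theory.
Import numFieldNormedType.Exports.

Local Open Scope classical_set_scope.
Local Open Scope ring_scope.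

Definition rate_mx (R : realType) (n : nat) (Q : 'M[R]_n) : Prop :=
  (forall i j : 'I_n, i != j -> 0 <= Q i j) /\
  (forall i : 'I_n, \sum_j Q i j = 0).

Definition stochastic_mx (R : realType) (n : nat) (P : 'M[R]_n) : Prop :=
  (forall i j : 'I_n, 0 <= P i j) /\
  (forall i : 'I_n, \sum_j P i j = 1).

(* The limit is taken for the topology of the max norm on matrices. *)
Definition expmx (R : realType) (n : nat) (Q : 'M[R]_n.+1) : 'M[R]_n.+1 :=
  limn (series (fun k : nat => (k`!%:R)^-1 *: Q ^+ k)).

Definition embeddable (R : realType) (P : 'M[R]_3) : Prop :=
  exists Q : 'M[R]_3, rate_mx Q /\ P = expmx Q.

Definition triangle_ineq (R : realType) (x y z : R) : bool :=
  [&& z < x + y, x < y + z & y < x + z].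

Definition threshold_b (R : realType) (mu1 mu2 mu3 : R) : R :=
  4 * mu1 * mu2 * mu3 / (mu1 * mu2 + mu1 * mu3 + mu2 * mu3) ^+ 2 - 1.

Definition Lambda (R : realType) (mu1 mu2 mu3 : R) : R :=
  let b := threshold_b mu1 mu2 mu3 in
  let m := Num.min mu1 (Num.min mu2 mu3) in
  if triangle_ineq mu1^-1 mu2^-1 mu3^-1
  then - expR (- (pi / Num.sqrt b))
  else - expR (- (Num.sqrt ((1 - m) / m) * pi)).

Definition Pinfty (R : realType) (mu : 'cV[R]_3) : 'M[R]_3 :=
  (const_mx 1 : 'cV[R]_3) *m mu^T.

(* Main.v *)
Require Import Defs.
From mathcomp Require Import all_boot all_order all_algebra.
From mathcomp Require Import all_classical all_reals all_analysis.
From mathcomp Require Import ring lra.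

Set Implicit Arguments.
Unset Strict Implicit.
Unset Printing Implicit Defensive.

Import Order.TTheory GRing.Theory Num.Theory.
Import numFieldNormedType.Exports.

Local Open Scope classical_set_scope.
Local Open Scope ring_scope.

(** Write N = I - Pinf, so that P = Pinf + lambda N acts as lambda on
    the image of N, a plane called the plane N below. A generator Q with exp Q = P commutes with P, hence satisfies
    mu' Q = 0 and lives on that plane, where it is a 2 x 2 matrix whose
    exponential is the scalar lambda < 0. A real eigenvalue rho would give
    exp rho = lambda, so the eigenvalues are -a +- i beta with beta > 0, and
    then Q = -a N + beta J with J ^ 2 = -N and
      exp Q = Pinf + e^-a cos beta N + e^-a sin beta J.
    This equals P only if sin beta = 0 and cos beta = -1, so that beta >= pi and
    lambda = - e^-a ([embeddable_spectrum]). Conversely beta = pi is enough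
    ([embeddable_rot]), and the question becomes how small the ratio a / beta
    can be for a rate matrix with stationary vector mu.

    A matrix with Q e = 0 and mu' Q = 0 has mu_i Q_ij equal to a symmetric part
    with off-diagonal entries u, v, w plus c times the oriented 3-cycle
    ([balanced_mx]), and Q is a rate matrix iff |c| <= u, v, w. Its trace -2a is
    linear in (u, v, w), and the product a^2 + beta^2 of its two nonzero
    eigenvalues is, up to the factor mu_1 mu_2 mu_3, the quadratic form
    uv + uw + vw + c^2. Minimising a / beta amounts to maximising this form at
    fixed trace. With r, s, t the reciprocals of the mu_i, the two inequalities
    [trace_minor_bound] and [trace_minor_bound_triangle] solve the problem: if
    r, s, t satisfy the triangle inequality the maximum is at u = v = w = c (a
    pure cyclic flow), otherwise it is on the face where the two edges at the
    smallest mass carry u = v = c. The minimal ratio is 1 / sqrt b in the first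
    case and sqrt ((1 - m) / m) in the second ([Lambda_sharp]). *)

(** * The exponential series of a complex number, in real coordinates *)

Section RotationSeries.
Variables (R : realType) (a b : R).

(** The real and imaginary parts of (a + i b) ^ k. *)
Fixpoint cpow (k : nat) : R * R :=
  if k is k'.+1 then
    let z := cpow k' in (a * z.1 - b * z.2, b * z.1 + a * z.2)
  else (1, 0).

(** Taking all real combinations of the two parts makes the family of series
    closed under differentiation. *)
Definition rot_coeff (p q : R) (k : nat) : R :=
  (p * (cpow k).1 + q * (cpow k).2) / k`!%:R.

Definition rot_series (p q t : R) : R := limn (pseries (rot_coeff p q) t).

Lemma cpow_bound k :
  `|(cpow k).1| <= (`|a| + `|b|) ^+ k /\ `|(cpow k).2| <= (`|a| + `|b|) ^+ k.
Proof.
elim: k => [|k [IH1 IH2]] /=; first by rewrite normr1 normr0 expr0.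
have h (x y z : R) : `|y| <= z -> `|x * y| <= `|x| * z.
  by move=> yz; rewrite normrM ler_wpM2l.
rewrite exprS mulrDl; split.
  by rewrite (le_trans (ler_normB _ _))// lerD// h.
by rewrite (le_trans (ler_normD _ _))// addrC lerD// h.
Qed.

Lemma rot_series_cvg p q t : cvgn (pseries (rot_coeff p q) t).
Proof.
apply: normed_cvg.
apply: (@series_le_cvg _ _
  ((`|p| + `|q|) *: exp_coeff ((`|a| + `|b|) * `|t|))) => [k|k|k|].
- exact: normr_ge0.
- by rewrite mulr_ge0 ?addr_ge0// exp_coeff_ge0// mulr_ge0// addr_ge0.
- have [h1 h2] := cpow_bound k.
  rewrite /= /rot_coeff !normrM normfV normr_nat normrX.
  rewrite -[leRHS]/((`|p| + `|q|) * (((`|a| + `|b|) * `|t|) ^+ k / k`!%:R)).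
  rewrite exprMn mulrA mulrA [leRHS]mulrAC.
  rewrite ler_wpM2r ?exprn_ge0// ler_wpM2r ?invr_ge0//.
  rewrite (le_trans (ler_normD _ _))// !normrM mulrDl lerD// ler_wpM2l//.
- by apply: is_cvg_seriesZ; exact: is_cvg_series_exp_coeff.
Qed.

Lemma diffs_rot_coeff p q :
  pseries_diffs (rot_coeff p q) = rot_coeff (p * a + q * b) (q * a - p * b).
Proof.
apply/funext => k; rewrite /pseries_diffs /rot_coeff factS natrM /=.
have k0 : k`!%:R != 0 :> R by rewrite pnatr_eq0 -lt0n fact_gt0.
have k1 : k.+1%:R != 0 :> R by rewrite pnatr_eq0.
by move: k.+1%:R k`!%:R k1 k0 => c d c0 d0; field; rewrite c0 d0.
Qed.

Lemma is_derive_rot (p q t : R) :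
  is_derive t (1 : R) (rot_series p q)
    (rot_series (p * a + q * b) (q * a - p * b) t).
Proof.
rewrite /rot_series -diffs_rot_coeff.
apply: (@pseries_snd_diffs _ _ (`|t| + 1)).
- exact: rot_series_cvg.
- by rewrite diffs_rot_coeff; exact: rot_series_cvg.
- by rewrite !diffs_rot_coeff; exact: rot_series_cvg.
- by rewrite [ltRHS]ger0_norm ?ltrDl// addr_ge0.
Qed.

Lemma rot_seriesE p q t :
  rot_series p q t = p * rot_series 1 0 t + q * rot_series 0 1 t.
Proof.
apply/cvg_lim => //.
have -> : pseries (rot_coeff p q) t =
    (fun n => p * pseries (rot_coeff 1 0) t n +
              q * pseries (rot_coeff 0 1) t n).
  apply/funext => n; rewrite /pseries /series /= !mulr_sumr -big_split /=.
  by apply: eq_bigr => k _; rewrite /rot_coeff; ring.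
by apply: cvgD; apply: cvgMl_tmp; exact: rot_series_cvg.
Qed.

Lemma rot_series0 p q : rot_series p q 0 = p.
Proof.
apply/cvg_lim => //; rewrite -cvg_shiftS.
rewrite [X in X @ _ --> _](_ : _ = fun=> p); first exact: cvg_cst.
apply/funext => n; rewrite /pseries /series /= big_nat_recl//= big1 ?addr0.
  by rewrite /rot_coeff /= expr0 fact0; field.
by move=> k _; rewrite expr0n mulr0.
Qed.

(** C and S, the exponential series of the real and imaginary parts, solve
    C' = a C - b S and S' = b C + a S; rotating (C, S) back by the angle b t
    and scaling by exp (- a t) gives a constant. *)
Lemma rot_series1 :
  rot_series 1 0 1 = expR a * cos b /\ rot_series 0 1 1 = expR a * sin b.
Proof.
pose C := rot_series 1 0; pose S := rot_series 0 1.
have dC (t : R) : is_derive t (1 : R) C (a * C t - b * S t).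
  apply: is_derive_eq (is_derive_rot 1 0 t) _.
  by rewrite rot_seriesE /C /S; ring.
have dS (t : R) : is_derive t (1 : R) S (b * C t + a * S t).
  apply: is_derive_eq (is_derive_rot 0 1 t) _.
  by rewrite rot_seriesE /C /S; ring.
have dL (c t : R) : is_derive t (1 : R) (fun t : R => c * t) c.
  by apply: is_derive_eq; rewrite /GRing.scale /=; ring.
have dE (t : R) :
  is_derive t (1 : R) (fun t => expR (- a * t)) (expR (- a * t) * - a).
  exact: (is_derive1_comp (is_derive_expR _) (dL (- a) t)).
have dc (t : R) :
  is_derive t (1 : R) (fun t => cos (b * t)) (- sin (b * t) * b).
  exact: (is_derive1_comp (is_derive_cos _) (dL b t)).
have ds (t : R) : is_derive t (1 : R) (fun t => sin (b * t)) (cos (b * t) * b).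
  exact: (is_derive1_comp (is_derive_sin _) (dL b t)).
have kU t : expR (- a * t) * (C t * cos (b * t) + S t * sin (b * t)) = 1.
  pose f t := expR (- a * t) * (C t * cos (b * t) + S t * sin (b * t)).
  rewrite -[LHS]/(f t) (_ : f t = f 0).
    by rewrite /f /C /S !rot_series0 !mulr0 expR0 cos0; ring.
  apply: is_derive_0_is_cst => x; rewrite /f.
  apply: is_derive_eq; rewrite /GRing.scale /=; ring.
have kV t : expR (- a * t) * (S t * cos (b * t) - C t * sin (b * t)) = 0.
  pose f t := expR (- a * t) * (S t * cos (b * t) - C t * sin (b * t)).
  rewrite -[LHS]/(f t) (_ : f t = f 0).
    by rewrite /f /C /S !rot_series0 !mulr0 sin0; ring.
  apply: is_derive_0_is_cst => x; rewrite /f.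
  apply: is_derive_eq; rewrite /GRing.scale /=; ring.
have := kU 1; have := kV 1; have := cos2Dsin2 b; rewrite !mulr1 -/C -/S => cs.
have E : expR a * expR (- a) = 1 by exact: expRxMexpNx_1.
set e := expR (- a); move=> V U.
have X : e * C 1 = cos b.
  transitivity (e * C 1 * (cos b ^+ 2 + sin b ^+ 2)); first by rewrite cs mulr1.
  transitivity ((e * (C 1 * cos b + S 1 * sin b)) * cos b
     - (e * (S 1 * cos b - C 1 * sin b)) * sin b); first by ring.
  by rewrite U V; ring.
have Y : e * S 1 = sin b.
  transitivity (e * S 1 * (cos b ^+ 2 + sin b ^+ 2)); first by rewrite cs mulr1.
  transitivity ((e * (C 1 * cos b + S 1 * sin b)) * sin b
     + (e * (S 1 * cos b - C 1 * sin b)) * cos b); first by ring.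
  by rewrite U V; ring.
by rewrite -X -Y !mulrA E !mul1r.
Qed.

End RotationSeries.

(** * The matrix exponential *)

Section MatrixExponential.
Variable R : realType.

Lemma cvg_mx m n (u : nat -> 'M[R]_(m, n)) (M : 'M[R]_(m, n)) :
  (forall i j, u k i j @[k --> \oo] --> M i j) -> u @ \oo --> M.
Proof.
move=> uM; apply/cvgrPdist_le => /= e e0; near=> k.
rewrite [leLHS]/Num.Def.normr/= mx_normrE (bigmax_le _ (ltW e0))//= => i _.
rewrite !mxE; move: i; near: k; apply: filter_forall => /= i.
exact: (cvgrPdist_le _ _).1 (uM i.1 i.2) _ e0.
Unshelve. all: by end_near. Qed.

Lemma cvg_mx_coord m n (u : nat -> 'M[R]_(m, n)) (M : 'M[R]_(m, n)) i j :
  u @ \oo --> M -> u k i j @[k --> \oo] --> M i j.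
Proof.
by move=> uM; exact: (cvg_comp _ _ uM (@coord_continuous _ _ _ i j M)).
Qed.

Lemma cvg_mulmxr m n p (W : 'M[R]_(m, n)) (u : nat -> 'M[R]_(n, p))
  (M : 'M[R]_(n, p)) :
  u @ \oo --> M -> W *m u k @[k --> \oo] --> W *m M.
Proof.
move=> uM; apply: cvg_mx => i j; rewrite mxE.
rewrite [X in X @ _](_ : _ = fun k => \sum_l W i l * u k l j); last first.
  by apply/funext => k; rewrite mxE.
apply: cvg_big => [|l _]; first exact: add_continuous.
apply: cvgMl_tmp; exact: cvg_mx_coord.
Qed.

Lemma cvg_mulmxl m n p (W : 'M[R]_(n, p)) (u : nat -> 'M[R]_(m, n))
  (M : 'M[R]_(m, n)) :
  u @ \oo --> M -> u k *m W @[k --> \oo] --> M *m W.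
Proof.
move=> uM; apply: cvg_mx => i j; rewrite mxE.
rewrite [X in X @ _](_ : _ = fun k => \sum_l u k i l * W l j); last first.
  by apply/funext => k; rewrite mxE.
apply: cvg_big => [|l _]; first exact: add_continuous.
apply: cvgMr_tmp; exact: cvg_mx_coord.
Qed.

Variable n : nat.
Implicit Types Q N J : 'M[R]_n.+1.

Definition exp_partial Q : nat -> 'M[R]_n.+1 :=
  series (fun k : nat => (k`!%:R)^-1 *: Q ^+ k).

Lemma mx_pow_bound Q k i j :
  `|(Q ^+ k) i j| <= (\sum_i \sum_j `|Q i j|) ^+ k.
Proof.
set M := \sum_i _.
have M0 : 0 <= M by apply: sumr_ge0 => ? _; apply: sumr_ge0.
elim: k i j => [|k IH] i j.
  by rewrite !expr0 mxE; case: eqP => _; rewrite ?normr1 ?normr0.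
rewrite exprS mxE (le_trans (ler_norm_sum _ _ _))// exprS.
apply: (@le_trans _ _ ((\sum_l `|Q i l|) * M ^+ k)).
  by rewrite mulr_suml ler_sum// => l _; rewrite normrM ler_wpM2l.
rewrite ler_wpM2r ?exprn_ge0// /M [leRHS](bigD1 i)//= lerDl.
by apply: sumr_ge0 => ? _; apply: sumr_ge0.
Qed.

(** Each entry is dominated by the series of exp M, with M the sum of the
    absolute values of all entries of Q. *)
Lemma expmx_cvg Q : exp_partial Q @ \oo --> expmx Q.
Proof.
suff h i j : cvgn (fun k => exp_partial Q k i j).
  apply/cvg_ex; exists (\matrix_(i, j) limn (fun k => exp_partial Q k i j)).
  by apply: cvg_mx => i j; rewrite mxE; exact: h.
rewrite (_ : (fun k => _) = series (fun k => k`!%:R^-1 * (Q ^+ k) i j)).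
  apply: normed_cvg; set M := \sum_i \sum_j `|Q i j|.
  apply: (@series_le_cvg _ _ (exp_coeff M)) => [k|k|k|].
  - exact: normr_ge0.
  - by rewrite exp_coeff_ge0//; apply: sumr_ge0 => ? _; apply: sumr_ge0.
  - rewrite /= /exp_coeff /= normrM normfV normr_nat mulrC.
    by rewrite ler_wpM2r ?invr_ge0 ?ler0n// mx_pow_bound.
  - exact: is_cvg_series_exp_coeff.
apply/funext => k; rewrite /exp_partial /series /= summxE.
by apply: eq_bigr => l _; rewrite mxE.
Qed.

Lemma expmxE Q M : exp_partial Q @ \oo --> M -> expmx Q = M.
Proof. by move=> h; apply/cvg_lim. Qed.

(** Both sides are limits of the same partial sums. *)
Lemma expmx_comm Q : Q *m expmx Q = expmx Q *m Q.
Proof.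
apply: (@cvg_unique _ _ ((Q *m exp_partial Q k) @[k --> \oo])).
- exact: norm_hausdorff.
- by apply: cvg_mulmxr; exact: expmx_cvg.
rewrite [X in X @ _](_ : _ = fun k => exp_partial Q k *m Q).
  by apply: cvg_mulmxl; exact: expmx_cvg.
apply/funext => k; rewrite /exp_partial /series /= mulmx_sumr mulmx_suml.
apply: eq_bigr => l _; rewrite -scalemxAl -scalemxAr; congr (_ *: _).
by rewrite -[LHS]/(Q * Q ^+ l) -[RHS]/(Q ^+ l * Q) -exprS -exprSr.
Qed.

(** W intertwines Q with the scalar rho, so it turns the matrix series into the
    scalar one. *)
Lemma expmx_eigen m (W : 'M[R]_(m, n.+1)) Q rho :
  W *m Q = rho *: W -> W *m expmx Q = expR rho *: W.
Proof.
move=> WQ.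
have WQk k : W *m Q ^+ k = rho ^+ k *: W.
  elim: k => [|k IH]; first by rewrite !expr0 mulmx1 scale1r.
  rewrite exprSr -[Q ^+ k * Q]/(Q ^+ k *m Q) mulmxA IH -scalemxAl WQ.
  by rewrite scalerA -exprSr.
apply: (@cvg_unique _ _ ((W *m exp_partial Q k) @[k --> \oo])).
- exact: norm_hausdorff.
- by apply: cvg_mulmxr; exact: expmx_cvg.
apply: cvg_mx => i j; rewrite mxE.
rewrite [X in X @ _](_ : _ = fun k => series (exp_coeff rho) k * W i j).
  by apply: cvgMr_tmp; exact: is_cvg_series_exp_coeff.
apply/funext => k; rewrite /exp_partial /series /= mulmx_sumr summxE mulr_suml.
apply: eq_bigr => l _; rewrite -scalemxAr WQk !mxE /exp_coeff /=.
by rewrite mulrA (mulrC _ (rho ^+ l)).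
Qed.

(** N is the unit and J the imaginary unit of a copy of the complex numbers, so
    the powers with positive exponent are those of a + i b; only the power 0
    sees the complement 1 - N. *)
Lemma expmx_rot N J a b : N * N = N -> N * J = J -> J * N = J -> J * J = - N ->
  expmx (a *: N + b *: J) =
  (1 - N) + (expR a * cos b) *: N + (expR a * sin b) *: J.
Proof.
move=> NN NJ JN JJ.
have pw k : (a *: N + b *: J) ^+ k =
    (k == 0)%:R *: (1 - N) + (cpow a b k).1 *: N + (cpow a b k).2 *: J.
  elim: k => [|k IH].
    by rewrite expr0 /= !scale1r scale0r addr0 subrK.
  rewrite exprS IH /= scale0r add0r.
  have N0 : (a *: N + b *: J) * (1 - N) = 0.
    by rewrite mulrBr mulr1 mulrDl -!scalerAl NN JN subrr.
  rewrite -addrA mulrDr -scalerAr N0 scaler0 add0r.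
  rewrite mulrDr !mulrDl -!scalerAl -!scalerAr NN NJ JN JJ !scalerA scalerN.
  apply/matrixP => i j; rewrite !mxE; ring.
apply: expmxE.
rewrite [exp_partial _](_ : _ = fun k => (k != 0)%:R *: (1 - N) +
   pseries (rot_coeff a b 1 0) 1 k *: N + pseries (rot_coeff a b 0 1) 1 k *: J).
  have [<- <-] := rot_series1 a b.
  apply: cvgD; first apply: cvgD; first last.
  - apply: cvgZr_tmp; exact: rot_series_cvg.
  - apply: cvgZr_tmp; exact: rot_series_cvg.
  (* The coefficient of 1 - N is eventually 1. *)
  - rewrite -cvg_shiftS /=; apply: cvg_near_cst; near=> k.
    by rewrite scale1r.
apply/funext => k; rewrite /exp_partial /pseries /series /=.
elim: k => [|k IH]; first by rewrite !big_geq// !scale0r !addr0.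
rewrite !big_nat_recr//= IH pw /rot_coeff expr1n.
case: k {IH} => [|k]; last first.
  by apply/matrixP => i j; rewrite !mxE /=; ring.
rewrite !big_geq// /= fact0 invr1; apply/matrixP => i j; rewrite !mxE /=; ring.
Unshelve. all: by end_near. Qed.

End MatrixExponential.

(** * Generators with a given stationary vector *)

Lemma forall_ord3 (P : 'I_3 -> Prop) : P 0 -> P 1 -> P 2 -> forall i, P i.
Proof.
move=> P0 P1 P2 [[|[|[|//]]] hi].
- by rewrite (_ : Ordinal hi = 0)//; exact: val_inj.
- by rewrite (_ : Ordinal hi = 1)//; exact: val_inj.
- by rewrite (_ : Ordinal hi = 2)//; exact: val_inj.
Qed.

Lemma sum3E (V : nmodType) (F : 'I_3 -> V) : \sum_i F i = F 0 + F 1 + F 2.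
Proof.
rewrite !big_ord_recr big_ord0 /= add0r.
by congr (F _ + F _ + F _); exact: val_inj.
Qed.

Lemma matrix3P (T : Type) (A B : 'M[T]_3) :
  A 0 0 = B 0 0 -> A 0 1 = B 0 1 -> A 0 2 = B 0 2 ->
  A 1 0 = B 1 0 -> A 1 1 = B 1 1 -> A 1 2 = B 1 2 ->
  A 2 0 = B 2 0 -> A 2 1 = B 2 1 -> A 2 2 = B 2 2 -> A = B.
Proof. by move=> *; apply/matrixP; do 2!apply: forall_ord3. Qed.

(** Minus the trace of the matrix [balanced_mx] below, for mu = (x, y, z). *)
Definition neg_trace (R : realType) (x y z u v w : R) : R :=
  u * (y^-1 + z^-1) + v * (x^-1 + z^-1) + w * (x^-1 + y^-1).

(** The sum of its principal 2 x 2 minors: all cofactors of the matrix with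
    entries mu_i Q_ij are equal to the numerator, and x + y + z = 1. *)
Definition minor_sum (R : realType) (x y z u v w c : R) : R :=
  (u * v + u * w + v * w + c ^+ 2) / (x * y * z).

Section Generators.
Variables (R : realType) (mu : 'cV[R]_3).
Hypothesis mu_gt0 : forall i : 'I_3, 0 < mu i 0.
Hypothesis mu_sum1 : \sum_(i < 3) mu i 0 = 1.

Local Notation x := (mu 0 0).
Local Notation y := (mu 1 0).
Local Notation z := (mu 2 0).
Local Notation neg_tr := (neg_trace x y z).
Local Notation minors := (minor_sum x y z).
Local Notation N := (1%:M - Pinfty mu).

(** The general matrix with zero row sums and left null vector mu. After
    multiplying row i by mu_i, the symmetric part has off-diagonal entries u, v, w
    (opposite to the indices 0, 1, 2) and the antisymmetric part is c times the
    oriented cycle 0, 1, 2. *)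
Definition balanced_mx (u v w c : R) : 'M[R]_3 :=
  \matrix_(i, j) ((mu i 0)^-1 *
    nth 0 (nth [::] [:: [:: - (v + w); w + c; v - c];
                        [:: w - c; - (u + w); u + c];
                        [:: v + c; u - c; - (u + v)]] i) j).

Let mu_neq0 : [/\ x != 0, y != 0 & z != 0].
Proof. by split; rewrite gt_eqF. Qed.

Let zE : z = 1 - x - y.
Proof. by rewrite -mu_sum1 sum3E; ring. Qed.

Lemma PinftyE i j : Pinfty mu i j = mu j 0.
Proof. by rewrite mxE big_ord_recl big_ord0 !mxE mul1r addr0. Qed.

Lemma PinfCE i j : N i j = (i == j)%:R - mu j 0.
Proof. by rewrite mxE [(- Pinfty mu) i j]mxE PinftyE mxE. Qed.

Lemma balanced_mxE u v w c i j : balanced_mx u v w c i j = (mu i 0)^-1 *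
    nth 0 (nth [::] [:: [:: - (v + w); w + c; v - c];
                        [:: w - c; - (u + w); u + c];
                        [:: v + c; u - c; - (u + v)]] i) j.
Proof. by rewrite mxE. Qed.

Lemma mul3E (A B : 'M[R]_3) i j :
  (A *m B) i j = A i 0 * B 0 j + A i 1 * B 1 j + A i 2 * B 2 j.
Proof. by rewrite mxE sum3E. Qed.

Lemma N_idem : N *m N = N.
Proof. by apply: matrix3P; rewrite mul3E !PinfCE /= zE; ring. Qed.

Lemma balanced_mx_N u v w c : balanced_mx u v w c *m N = balanced_mx u v w c.
Proof.
have [x0 y0 z0] := mu_neq0.
by apply: matrix3P; rewrite mul3E !PinfCE !balanced_mxE /=; field.
Qed.

Lemma N_balanced_mx u v w c : N *m balanced_mx u v w c = balanced_mx u v w c.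
Proof.
have [x0 y0 z0] := mu_neq0.
by apply: matrix3P; rewrite mul3E !PinfCE !balanced_mxE /=; field;
  rewrite ?x0 ?y0 ?z0.
Qed.

(** Cayley-Hamilton on the plane N, where the determinant is the sum of the
    principal 2 x 2 minors. *)
Lemma balanced_mx_sqr u v w c : balanced_mx u v w c *m balanced_mx u v w c =
  - neg_tr u v w *: balanced_mx u v w c - minors u v w c *: N.
Proof.
have [x0 y0 z0] := mu_neq0.
have hz : 1 - x - y != 0 by rewrite -zE.
apply: matrix3P; rewrite mul3E [RHS]mxE [in RHS]mxE [X in _ = _ + X]mxE
  [X in _ = _ - X]mxE !PinfCE !balanced_mxE /= /neg_trace /minor_sum zE; field;
  by rewrite ?x0 ?y0 ?hz.
Qed.

(** The symmetric and antisymmetric parts of mu_i Q_ij give the parameters; the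
    two null vectors force the antisymmetric part to be a multiple of the
    cycle. *)
Lemma balanced_mxP (Q : 'M[R]_3) :
  (forall i, \sum_j Q i j = 0) -> (forall j, \sum_i mu i 0 * Q i j = 0) ->
  exists u v w c, Q = balanced_mx u v w c.
Proof.
have [x0 y0 z0] := mu_neq0.
move=> r k.
have xr i : mu i 0 * (Q i 0 + Q i 1 + Q i 2) = 0 by rewrite -sum3E r mulr0.
have := (xr 0, xr 1, xr 2); have := (k 0, k 1, k 2).
rewrite !sum3E => -[[k0 k1] k2] [[r0 r1] r2].
exists ((y * Q 1 2 + z * Q 2 1) / 2), ((x * Q 0 2 + z * Q 2 0) / 2),
  ((x * Q 0 1 + y * Q 1 0) / 2), ((x * Q 0 1 - y * Q 1 0) / 2).
apply: matrix3P; rewrite balanced_mxE /=;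
  [apply: (mulfI x0)|apply: (mulfI x0)|apply: (mulfI x0)
  |apply: (mulfI y0)|apply: (mulfI y0)|apply: (mulfI y0)
  |apply: (mulfI z0)|apply: (mulfI z0)|apply: (mulfI z0)];
  rewrite mulVKf//; lra.
Qed.

End Generators.

(** * Two inequalities between trace and minors *)

Section Scalar.
Variable R : realType.
Implicit Types r s t u v w : R.

(** Split the linear form as X + Y with X = t (u + v) and use
    4 X Y <= (X + Y) ^ 2; both (u + v) (u + w) and (u + v) (v + w) are at least
    the quadratic form on the left, since c ^ 2 <= u ^ 2 and c ^ 2 <= v ^ 2. *)
Lemma trace_minor_bound r s t u v w c : 0 < r -> 0 < s -> 0 < t ->
  `|c| <= u -> `|c| <= v -> `|c| <= w ->
  4 * t * (r + s) * (u * v + u * w + v * w + c ^+ 2) <=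
  (u * (s + t) + v * (r + t) + w * (r + s)) ^+ 2.
Proof.
move=> r0 s0 t0 cu cv cw.
have c0 := normr_ge0 c.
have cc : c ^+ 2 = `|c| ^+ 2 by rewrite real_normK ?num_real.
move: (`|c|) c0 cu cv cw cc => d d0 cu cv cw ->.
have du : d ^+ 2 <= u ^+ 2 by rewrite lerXn2r// nnegrE; lra.
have dv : d ^+ 2 <= v ^+ 2 by rewrite lerXn2r// nnegrE; lra.
set X := t * (u + v); set Y := s * (u + w) + r * (v + w).
have -> : u * (s + t) + v * (r + t) + w * (r + s) = X + Y.
  by rewrite /X /Y; ring.
apply: (@le_trans _ _ (4 * X * Y)); last first.
  by rewrite -subr_ge0 (_ : _ - _ = (X - Y) ^+ 2) ?sqr_ge0//; ring.
rewrite -subr_ge0 (_ : _ - _ =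
    4 * t * (s * (u ^+ 2 - d ^+ 2) + r * (v ^+ 2 - d ^+ 2))).
  by rewrite mulr_ge0 ?addr_ge0 ?mulr_ge0//; lra.
rewrite /X /Y; ring.
Qed.


(** The reversed Cauchy-Schwarz inequality for the Lorentzian form
    uv + uw + vw, for which (r, s, t) is time-like. Subtracting from (u, v, w)
    the multiple of (r, s, t) by (u + v) / (r + s) leaves a vector whose first
    two coordinates add up to zero, on which the form is nonpositive. *)
Lemma reversed_cauchy_schwarz r s t u v w : 0 < r -> 0 < s -> 0 < t ->
  4 * (r * s + r * t + s * t) * (u * v + u * w + v * w) <=
  (u * (s + t) + v * (r + t) + w * (r + s)) ^+ 2.
Proof.
move=> r0 s0 t0; set L := (X in X ^+ 2); set E := r * s + r * t + s * t.
have E0 : 0 < E by rewrite !addr_gt0 ?mulr_gt0.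
rewrite -subr_ge0 -(@pmulr_rge0 _ ((r + s) ^+ 2)) ?exprn_gt0 ?addr_gt0//.
rewrite [X in 0 <= X](_ : _ = ((r + s) * L - 2 * (u + v) * E) ^+ 2
    + 4 * E * (u * s - v * r) ^+ 2); last by rewrite /L /E; ring.
by rewrite addr_ge0 ?sqr_ge0// mulr_ge0 ?sqr_ge0// mulr_ge0 ?ltW.
Qed.

(** Subtract d = |c| from each coordinate: the terms in d ^ 2 agree, the terms
    linear in d are compared by the triangle inequality, and the remaining ones by
    [reversed_cauchy_schwarz], since (r + s + t) ^ 2 <= 4 (rs + rt + st). *)
Lemma trace_minor_bound_triangle r s t u v w c :
  0 < r -> 0 < s -> 0 < t -> r <= s + t -> s <= r + t -> t <= r + s ->
  `|c| <= u -> `|c| <= v -> `|c| <= w ->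
  (r + s + t) ^+ 2 * (u * v + u * w + v * w + c ^+ 2) <=
  (u * (s + t) + v * (r + t) + w * (r + s)) ^+ 2.
Proof.
move=> r0 s0 t0 tr ts tt cu cv cw.
have c0 := normr_ge0 c.
have cc : c ^+ 2 = `|c| ^+ 2 by rewrite real_normK ?num_real.
move: (`|c|) c0 cu cv cw cc => d d0 cu cv cw ->.
set p := u - d; set q := v - d; set o := w - d.
have [p0 q0 o0] : [/\ 0 <= p, 0 <= q & 0 <= o] by split; rewrite subr_ge0.
have -> : u = d + p by rewrite /p; ring.
have -> : v = d + q by rewrite /q; ring.
have -> : w = d + o by rewrite /o; ring.
set S := r + s + t; set L := p * (s + t) + q * (r + t) + o * (r + s).
set e := p * q + p * o + q * o.
have S2 : S ^+ 2 <= 4 * (r * s + r * t + s * t).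
  rewrite -subr_ge0 (_ : _ - _ =
    r * (s + t - r) + s * (r + t - s) + t * (r + s - t)).
    by rewrite !addr_ge0// mulr_ge0 ?subr_ge0// ltW.
  by rewrite /S; ring.
have e0 : 0 <= e by rewrite !addr_ge0 ?mulr_ge0.
have SeL : S ^+ 2 * e <= L ^+ 2.
  apply: le_trans (reversed_cauchy_schwarz p q o r0 s0 t0).
  by rewrite ler_wpM2r.
rewrite -subr_ge0 (_ : _ - _ = (L ^+ 2 - S ^+ 2 * e) + 2 * S * d *
   (p * (s + t - r) + q * (r + t - s) + o * (r + s - t))).
  rewrite addr_ge0 ?subr_ge0// mulr_ge0//.
    by rewrite !mulr_ge0// /S !addr_ge0// ltW.
  by rewrite !addr_ge0// mulr_ge0 ?subr_ge0.
by rewrite /L /e /S; ring.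
Qed.
End Scalar.

(** * Embeddability in terms of trace and minors *)

Lemma norm_leP (R : realType) (c u : R) :
  `|c| <= u <-> 0 <= u + c /\ 0 <= u - c.
Proof.
rewrite ler_norml; split=> [/andP[h1 h2]|[h1 h2]]; first by split; lra.
by apply/andP; split; lra.
Qed.

Section Embedding.
Variables (R : realType) (mu : 'cV[R]_3).
Hypothesis mu_gt0 : forall i : 'I_3, 0 < mu i 0.
Hypothesis mu_sum1 : \sum_(i < 3) mu i 0 = 1.

Local Notation x := (mu 0 0).
Local Notation y := (mu 1 0).
Local Notation z := (mu 2 0).
Local Notation N := (1%:M - Pinfty mu).

Let NN : N *m N = N. Proof. exact: N_idem. Qed.
Let x0 : 0 < x := mu_gt0 0.
Let y0 : 0 < y := mu_gt0 1.
Let z0 : 0 < z := mu_gt0 2.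

(** For a = T pi, mu_i times the off-diagonal entry (i, j) is pi times
    T mu_i mu_j + u +- c (or v, w for u), which the bounds make nonnegative; a
    larger a adds a positive multiple of the rate matrix - N. *)
Lemma rate_rot (u v w c a T : R) : T * pi <= a ->
  `|c| <= T * (y * z) + u -> `|c| <= T * (x * z) + v ->
  `|c| <= T * (x * y) + w ->
  rate_mx (- a *: N + pi *: balanced_mx mu u v w c).
Proof.
move=> Ta /norm_leP[u1 u2] /norm_leP[v1 v2] /norm_leP[w1 w2].
have E i j : (- a *: N + pi *: balanced_mx mu u v w c) i j =
    - a * N i j + pi * balanced_mx mu u v w c i j.
  by rewrite mxE [X in X + _]mxE [X in _ + X]mxE.
have pi0 := pi_ge0 R.
have h (r p q e : R) : 0 < r -> 0 < p -> q = T * (r * p) + e -> 0 <= q ->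
    0 <= - a * (0 - p) + pi * (r^-1 * e).
  move=> r0 p0 -> q0.
  rewrite -(pmulr_rge0 _ r0).
  have -> : r * (- a * (0 - p) + pi * (r^-1 * e)) =
      (a - T * pi) * (r * p) + pi * (T * (r * p) + e) by field; rewrite gt_eqF.
  by rewrite addr_ge0// mulr_ge0// ?subr_ge0// mulr_ge0// ltW.
split.
- apply: forall_ord3; apply: forall_ord3 => //= _;
    rewrite E PinfCE balanced_mxE /=.
  + by apply: h w1 => //; ring.
  + by apply: h v2 => //; ring.
  + by apply: h w2 => //; ring.
  + by apply: h u1 => //; ring.
  + by apply: h v1 => //; ring.
  + by apply: h u2 => //; ring.
- have s1 := mu_sum1; rewrite sum3E in s1.
  have zE : z = 1 - x - y by rewrite -s1; ring.
  by apply: forall_ord3; rewrite sum3E !E !PinfCE !balanced_mxE /= zE; ring.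
Qed.

(** The parameters describe a J with J ^ 2 = -N, and a rotation by pi is -1 on
    the plane N. *)
Lemma embeddable_rot (u v w c a T : R) : T * pi <= a ->
  neg_trace x y z u v w = 0 -> minor_sum x y z u v w c = 1 ->
  `|c| <= T * (y * z) + u -> `|c| <= T * (x * z) + v ->
  `|c| <= T * (x * y) + w ->
  embeddable (Pinfty mu + - expR (- a) *: N).
Proof.
move=> Ta tr det hu hv hw; exists (- a *: N + pi *: balanced_mx mu u v w c).
split; first exact: rate_rot hu hv hw.
rewrite expmx_rot.
- by rewrite cospi sinpi mulrN1 mulr0 scale0r addr0 subKr.
- exact: NN.
- exact: N_balanced_mx.
- exact: balanced_mx_N.
- rewrite -[LHS]/(balanced_mx mu u v w c *m balanced_mx mu u v w c).
  rewrite balanced_mx_sqr//.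
  by rewrite tr det oppr0 scale0r scale1r sub0r.
Qed.

Variable lambda : R.
Hypothesis lambda_lt0 : lambda < 0.
Local Notation P := (Pinfty mu + lambda *: N).

(** W P = lambda W, while a real eigenvalue rho gives W (exp Q) = (exp rho) W. *)
Lemma no_real_eigen Q (W : 'M[R]_3) rho : P = expmx Q ->
  W *m Q = rho *: W -> W *m N = W -> W = 0.
Proof.
move=> PQ WQ WN; have := expmx_eigen WQ.
have WP : W *m Pinfty mu = 0.
  by rewrite -[Pinfty mu](subKr 1%:M) mulmxBr mulmx1 WN subrr.
rewrite -PQ mulmxDr WP add0r -scalemxAr WN => /eqP.
rewrite -subr_eq0 -scalerBl scaler_eq0 => /orP[|/eqP//].
by rewrite lt_eqF// subr_lt0 (lt_trans lambda_lt0)// expR_gt0.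
Qed.

(** Q commutes with its exponential P, hence with Pinf = e mu'. As Q e = 0 this
    gives e (mu' Q) = 0. *)
Lemma embeddable_balanced Q : rate_mx Q -> P = expmx Q ->
  exists u v w c, Q = balanced_mx mu u v w c.
Proof.
move=> [_ rows] PQ; apply: balanced_mxP => // j.
have QP : Q *m Pinfty mu = 0.
  rewrite mulmxA (_ : Q *m _ = 0) ?mul0mx//.
  apply/matrixP => i k; rewrite mxE [RHS]mxE -[RHS](rows i).
  by apply: eq_bigr => l _; rewrite mxE mulr1.
have := expmx_comm Q; rewrite -PQ.
have -> : P = lambda%:M + (1 - lambda) *: Pinfty mu.
  by apply/matrixP => i k; rewrite !mxE; ring.
rewrite mulmxDr mulmxDl -scalemxAr -scalemxAl QP scaler0 addr0.
rewrite mul_mx_scalar mul_scalar_mx => /eqP.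
rewrite -subr_eq0 opprD addrA subrr sub0r oppr_eq0 scaler_eq0 => /orP[|/eqP].
  by rewrite gt_eqF// subr_gt0 (lt_trans lambda_lt0).
move=> /matrixP /(_ 0 j); rewrite mul3E [RHS]mxE !PinftyE => PQ0.
by rewrite sum3E.
Qed.

(** Here -a +- i beta are the eigenvalues on the plane N of a rate matrix whose
    exponential is P, and u, v, w, c are its parameters. The sign of lambda
    makes beta an odd multiple of pi, of which only the lower bound matters. *)
Lemma embeddable_spectrum : embeddable P ->
  exists a beta u v w c : R, [/\ lambda = - expR (- a), pi <= beta,
    neg_trace x y z u v w = 2 * a &
    minor_sum x y z u v w c = a ^+ 2 + beta ^+ 2] /\
  [/\ `|c| <= u, `|c| <= v & `|c| <= w].
Proof.
move=> [Q [rQ PQ]].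
have [u [v [w [c QE]]]] := embeddable_balanced rQ PQ.
set d := minor_sum x y z u v w c; pose a := neg_trace x y z u v w / 2.
have trE : neg_trace x y z u v w = 2 * a by rewrite /a; field.
have QN : Q *m N = Q by rewrite QE balanced_mx_N.
have NQ : N *m Q = Q by rewrite QE N_balanced_mx.
have QQ : Q *m Q = - (2 * a) *: Q - d *: N by rewrite -trE QE balanced_mx_sqr.
have N0 : N != 0.
  apply/eqP => /matrixP /(_ 0 1); rewrite PinfCE mxE /= => /eqP.
  by rewrite sub0r oppr_eq0 gt_eqF.
(* K is the traceless part of Q on the plane N. *)
pose K := Q + a *: N.
have KK : K *m K = (a ^+ 2 - d) *: N.
  rewrite /K mulmxDl !mulmxDr -!scalemxAl -!scalemxAr QN NQ NN QQ.
  by apply/matrixP => i j; rewrite !mxE; ring.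
have KN : K *m N = K by rewrite /K mulmxDl -scalemxAl QN NN.
have NK : N *m K = K by rewrite /K mulmxDr -scalemxAr NQ NN.
have QK : Q = K - a *: N by rewrite /K addrK.
clearbody K.
(* If d <= a ^ 2 then K ^ 2 = e ^ 2 N with e real: the rows of K + e N are
   eigenvectors of K for e unless K = - e N, and then those of N are
   eigenvectors for - e. *)
have da : a ^+ 2 < d.
  rewrite ltNge; apply/negP => ad; set e := Num.sqrt (a ^+ 2 - d).
  have e2 : a ^+ 2 - d = e ^+ 2 by rewrite sqr_sqrtr// subr_ge0.
  have W0 : K + e *: N = 0.
    apply: (no_real_eigen (rho := e - a) PQ) => //.
      rewrite QK mulmxBr -scalemxAr !mulmxDl KK -!scalemxAl KN NK NN e2.
      by apply/matrixP => i j; rewrite !mxE; ring.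
    by rewrite mulmxDl -scalemxAl KN NN.
  have KE : K = - e *: N by apply/eqP; rewrite scaleNr -addr_eq0 W0.
  suff N00 : N = 0 by rewrite N00 eqxx in N0.
  apply: (no_real_eigen (rho := - e - a) PQ) => //.
  by rewrite QK KE mulmxBr -!scalemxAr NN scalerBl.
pose beta := Num.sqrt (d - a ^+ 2).
have b0 : 0 < beta by rewrite sqrtr_gt0 subr_gt0.
have b2 : beta ^+ 2 = d - a ^+ 2 by rewrite sqr_sqrtr// subr_ge0 ltW.
pose J := beta^-1 *: K.
have bJ : beta *: J = K by rewrite /J scalerA divff ?gt_eqF// scale1r.
have JJ : J *m J = - N.
  rewrite /J -scalemxAl -scalemxAr KK !scalerA -[RHS]scaleN1r; congr (_ *: _).
  have -> : a ^+ 2 - d = - beta ^+ 2 by rewrite b2 opprB.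
  by field; rewrite gt_eqF.
have JN : J *m N = J by rewrite /J -scalemxAl KN.
have NJ : N *m J = J by rewrite /J -scalemxAr NK.
clearbody J.
have := expmx_rot (- a) beta NN NJ JN JJ.
rewrite bJ [X in expmx X](_ : _ = Q); last by rewrite QK addrC scaleNr.
rewrite -PQ => PE.
have CS :
    (expR (- a) * cos beta - lambda) *: N + (expR (- a) * sin beta) *: J = 0.
  move: PE; rewrite subKr -addrA => /addrI /eqP.
  rewrite eq_sym -subr_eq0 => /eqP <-.
  by apply/matrixP => i j; rewrite !mxE; ring.
set C := _ - lambda in CS; set S := expR (- a) * sin beta in CS.
(* N and J span a copy of the complex numbers; multiply C + S J = 0 by its
   conjugate. *)
have CS0 : C ^+ 2 + S ^+ 2 = 0.
  have : (C *: N + S *: J) *m (C *: N - S *: J) = 0 by rewrite CS mul0mx.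
  rewrite mulmxBr !mulmxDl -!scalemxAl -!scalemxAr NN NJ JN JJ.
  rewrite [LHS](_ : _ = (C ^+ 2 + S ^+ 2) *: N); last first.
    by apply/matrixP => i j; rewrite !mxE; ring.
  by move=> /eqP; rewrite scaler_eq0 (negbTE N0) orbF => /eqP.
move/eqP: CS0; rewrite paddr_eq0 ?sqr_ge0// !sqrf_eq0 => /andP[C0 S0].
have sb : sin beta = 0.
  by move: S0; rewrite mulf_eq0 gt_eqF ?expR_gt0//= => /eqP.
have lE : lambda = expR (- a) * cos beta by move: C0; rewrite subr_eq0 => /eqP.
have cb : cos beta = -1.
  have := cos2Dsin2 beta; rewrite sb expr0n addr0 => /eqP; rewrite sqrf_eq1.
  move=> /orP[/eqP c1|/eqP//]; move: lambda_lt0.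
  by rewrite lE c1 mulr1 ltNge expR_ge0.
exists a, beta, u, v, w, c; split; first split => //.
- by rewrite lE cb mulrN1.
- rewrite leNgt; apply/negP => bpi.
  by have := sin_gt0_pi (x := beta); rewrite b0 bpi sb ltxx => /(_ isT).
- by rewrite b2 -/d; ring.
case: rQ => rQ _; have h (r e : R) : 0 < r -> 0 <= r^-1 * e -> 0 <= e.
  by move=> r0; rewrite pmulr_rge0// invr_gt0.
have := (rQ 1 2 isT, rQ 2 1 isT, rQ 0 2 isT, rQ 2 0 isT, rQ 0 1 isT,
  rQ 1 0 isT).
rewrite QE !balanced_mxE /= => -[[[[[/h h1 /h h2] /h h3] /h h4] /h h5] /h h6].
by split; apply/norm_leP; split; auto.
Qed.

End Embedding.

(** * The minimal ratio of damping to rotation *)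

Section Threshold.
Variable R : realType.
Implicit Types x y z T : R.

(** The ratio a / beta = T is reached by a rate matrix: for a = T and beta = 1
    its symmetric part has off-diagonal entries T yz + u, T xz + v and T xy + w, and
    (u, v, w, c) are the parameters of J. *)
Definition attained x y z T : Prop := exists u v w c : R,
  [/\ neg_trace x y z u v w = 0
    & minor_sum x y z u v w c = 1] /\
  [/\ `|c| <= T * (y * z) + u, `|c| <= T * (x * z) + v
    & `|c| <= T * (x * y) + w].

Definition lower_bound x y z T : Prop := forall a beta u v w c : R,
  neg_trace x y z u v w = 2 * a ->
  minor_sum x y z u v w c = a ^+ 2 + beta ^+ 2 ->
  `|c| <= u -> `|c| <= v -> `|c| <= w -> T * beta <= a.

Definition sharp x y z T := attained x y z T /\ lower_bound x y z T.

Lemma sharp_swap12 x y z T : sharp x y z T -> sharp y x z T.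
Proof.
move=> [[u [v [w [c [[tr det] [hu hv hw]]]]]] lb]; split.
  exists v, u, w, c; split; split=> //.
  - by rewrite -tr /neg_trace; ring.
  - by rewrite -det /minor_sum (mulrC y x); congr (_ / _); ring.
  - by rewrite (mulrC y).
move=> a beta u' v' w' c' tr' det' hu' hv' hw'.
apply: (lb a beta v' u' w' c') => //; first by rewrite -tr' /neg_trace; ring.
by rewrite -det' /minor_sum (mulrC y x); congr (_ / _); ring.
Qed.

Lemma sharp_swap23 x y z T : sharp x y z T -> sharp x z y T.
Proof.
move=> [[u [v [w [c [[tr det] [hu hv hw]]]]]] lb]; split.
  exists u, w, v, c; split; split=> //.
  - by rewrite -tr /neg_trace; ring.
  - by rewrite -det /minor_sum mulrAC; congr (_ / _); ring.
  - by rewrite (mulrC z).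
move=> a beta u' v' w' c' tr' det' hu' hv' hw'.
apply: (lb a beta u' w' v' c') => //; first by rewrite -tr' /neg_trace; ring.
by rewrite -det' /minor_sum mulrAC; congr (_ / _); ring.
Qed.

Lemma le_of_sqr (a b : R) : 0 <= a -> b ^+ 2 <= a ^+ 2 -> b <= a.
Proof.
move=> a0; have [b0|b0 _] := leP 0 b; first by rewrite ler_sqr// nnegrE.
exact: le_trans (ltW b0) a0.
Qed.

Lemma trace_ge0 x y z (u v w a c : R) : 0 < x -> 0 < y -> 0 < z ->
  `|c| <= u -> `|c| <= v -> `|c| <= w ->
  neg_trace x y z u v w = 2 * a ->
  0 <= a.
Proof.
move=> x0 y0 z0 cu cv cw tr; have c0 := normr_ge0 c.
rewrite -(pmulr_rge0 a (x := 2))// -tr /neg_trace.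
have [u0 v0 w0] := And3 (le_trans c0 cu) (le_trans c0 cv) (le_trans c0 cw).
by rewrite !addr_ge0// mulr_ge0// addr_ge0// invr_ge0 ltW.
Qed.

(** The third mass is the smallest one. The optimal symmetric part for a = 1 has
    entries z/2, z/2 and xy/(x + y) - z/2 and cyclic part z/2: this is the
    equality case of [trace_minor_bound]. *)
Lemma sharp_obtuse x y z : 0 < x -> 0 < y -> 0 < z -> x + y + z = 1 ->
  x^-1 + y^-1 <= z^-1 -> sharp x y z (Num.sqrt ((1 - z) / z)).
Proof.
move=> x0 y0 z0 s1 obt; set T := Num.sqrt _.
have xy1 : x + y = 1 - z by rewrite -s1; ring.
have z1 : 0 < 1 - z by rewrite -xy1 addr_gt0.
have T2 : T ^+ 2 = (1 - z) / z by rewrite sqr_sqrtr// divr_ge0// ltW.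
have T0 : 0 <= T := sqrtr_ge0 _.
have [xn yn zn] : [/\ x != 0, y != 0 & z != 0] by rewrite !gt_eqF.
have xyn : x + y != 0 by rewrite gt_eqF// addr_gt0.
split.
  pose c := z / 2; pose w := x * y / (x + y) - z / 2.
  have cw : c <= w.
    rewrite /c /w -(ler_pM2l (x := z^-1 * (x^-1 + y^-1))); last first.
      by rewrite mulr_gt0 ?addr_gt0 ?invr_gt0.
    rewrite -subr_ge0 [X in 0 <= X](_ : _ = z^-1 - (x^-1 + y^-1)) ?subr_ge0//.
    by field; rewrite xn yn zn xyn.
  have c0 : 0 <= c by rewrite divr_ge0// ltW.
  exists (T * (c - y * z)), (T * (c - x * z)), (T * (w - x * y)), (T * c).
  have zE : z = 1 - x - y by rewrite -s1; ring.
  split; split.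
  - transitivity (T * (1 - x - y - z) * 2); last by rewrite zE; ring.
    by rewrite /neg_trace /c /w; field; rewrite xn yn zn xyn.
  - transitivity (T ^+ 2 * (((c - y * z) * (c - x * z) + (c - y * z) * (w - x * y)
      + (c - x * z) * (w - x * y) + c ^+ 2) / (x * y * z))).
      by rewrite /minor_sum; field; rewrite xn yn zn.
    have zn' : 1 - x - y != 0 by rewrite -zE.
    by rewrite T2 /c /w zE; field; rewrite xn yn zn' xyn.
  - by rewrite -mulrDr addrC subrK ger0_norm// mulr_ge0.
  - by rewrite -mulrDr addrC subrK ger0_norm// mulr_ge0.
  - rewrite (_ : _ + _ = T * w); last by ring.
    by rewrite ger0_norm; [rewrite ler_wpM2l | exact: mulr_ge0].
move=> a beta u v w c tr det cu cv cw.
have a0 := trace_ge0 x0 y0 z0 cu cv cw tr.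
apply: le_of_sqr => //; rewrite exprMn T2.
have [xi yi zi] : [/\ 0 < x^-1, 0 < y^-1 & 0 < z^-1] by rewrite !invr_gt0.
have := trace_minor_bound xi yi zi cu cv cw.
rewrite -/(neg_trace x y z u v w) tr.
have -> : u * v + u * w + v * w + c ^+ 2 = (a ^+ 2 + beta ^+ 2) * (x * y * z).
  by rewrite -det /minor_sum divfK// !mulf_neq0.
have -> : 4 * z^-1 * (x^-1 + y^-1) * ((a ^+ 2 + beta ^+ 2) * (x * y * z)) =
   4 * (1 - z) * (a ^+ 2 + beta ^+ 2).
  by rewrite -xy1; field; rewrite xn yn zn.
move=> B; rewrite mulrAC ler_pdivrMr//.
lra.
Qed.

(** The optimum is a pure cyclic flow: for a = 1 all of u, v, w, c are equal to
    xyz/(xy + xz + yz). *)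
Lemma sharp_acute x y z : 0 < x -> 0 < y -> 0 < z -> x + y + z = 1 ->
  triangle_ineq x^-1 y^-1 z^-1 -> sharp x y z (Num.sqrt (threshold_b x y z))^-1.
Proof.
move=> x0 y0 z0 s1 /and3P[tz tx ty]; set T := _^-1.
have [xn yn zn] : [/\ x != 0, y != 0 & z != 0] by rewrite !gt_eqF.
have [xi yi zi] : [/\ 0 < x^-1, 0 < y^-1 & 0 < z^-1] by rewrite !invr_gt0.
set e := x * y + x * z + y * z.
have e0 : 0 < e by rewrite !addr_gt0// mulr_gt0.
have en : e != 0 by rewrite gt_eqF.
have bE : threshold_b x y z = 4 * (x * y * z) / e ^+ 2 - 1.
  by rewrite /threshold_b -/e !mulrA.
have b0 : 0 < threshold_b x y z.
  rewrite bE subr_gt0 ltr_pdivlMr ?exprn_gt0// mul1r -subr_gt0.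
  have -> : 4 * (x * y * z) = 4 * (x * y * z) * (x + y + z) by rewrite s1 mulr1.
  rewrite /e.
  rewrite [X in 0 < X](_ : _ = (x * y * z) ^+ 2 *
    (x^-1 * (y^-1 + z^-1 - x^-1) + y^-1 * (x^-1 + z^-1 - y^-1)
     + z^-1 * (x^-1 + y^-1 - z^-1))); last by field; rewrite xn yn zn.
  by rewrite mulr_gt0 ?exprn_gt0 ?mulr_gt0// !addr_gt0// mulr_gt0// subr_gt0.
have T2 : T ^+ 2 = (threshold_b x y z)^-1 by rewrite exprVn sqr_sqrtr// ltW.
have T0 : 0 <= T by rewrite invr_ge0 sqrtr_ge0.
split.
  pose c := x * y * z / e.
  have c0 : 0 <= c by rewrite divr_ge0 ?mulr_ge0// ltW.
  exists (T * (c - y * z)), (T * (c - x * z)), (T * (c - x * y)), (T * c).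
  split; split; try by rewrite -mulrDr addrC subrK ger0_norm// mulr_ge0.
  - transitivity (T * (1 - (x + y + z)) * 2); last by rewrite s1; ring.
    rewrite /neg_trace /c /e; field; rewrite -/e.
    by rewrite xn yn zn en.
  - transitivity (T ^+ 2 * (((c - y * z) * (c - x * z) + (c - y * z) * (c - x * y)
      + (c - x * z) * (c - x * y) + c ^+ 2) / (x * y * z))).
      by rewrite /minor_sum; field; rewrite xn yn zn.
    rewrite [X in _ * X](_ : _ = threshold_b x y z).
      by rewrite T2 mulVf// gt_eqF.
    transitivity (4 * (x * y * z) / e ^+ 2 + (x + y + z) - 2);
      last by rewrite s1 bE; ring.
    rewrite /c /e; field.
    by rewrite xn yn zn -/e en.
move=> a beta u v w c tr det cu cv cw.
have a0 := trace_ge0 x0 y0 z0 cu cv cw tr.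
apply: le_of_sqr => //; rewrite exprMn T2 mulrC ler_pdivrMr// bE.
have := trace_minor_bound_triangle xi yi zi (ltW tx) (ltW ty) (ltW tz) cu cv cw.
rewrite -/(neg_trace x y z u v w) tr.
have -> : u * v + u * w + v * w + c ^+ 2 = (a ^+ 2 + beta ^+ 2) * (x * y * z).
  by rewrite -det /minor_sum divfK// !mulf_neq0.
have -> : (x^-1 + y^-1 + z^-1) ^+ 2 * ((a ^+ 2 + beta ^+ 2) * (x * y * z)) =
   e ^+ 2 * (a ^+ 2 + beta ^+ 2) / (x * y * z).
  by rewrite /e; field; rewrite xn yn zn.
rewrite ler_pdivrMr ?mulr_gt0// => B.
rewrite [leRHS](_ : _ = a ^+ 2 * (4 * (x * y * z)) / e ^+ 2 - a ^+ 2); last first.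
  by ring.
rewrite lerBrDr ler_pdivlMr ?exprn_gt0//.
lra.
Qed.

Lemma Lambda_sharp x y z : 0 < x -> 0 < y -> 0 < z -> x + y + z = 1 ->
  exists T, [/\ 0 <= T, sharp x y z T & Lambda x y z = - expR (- (T * pi))].
Proof.
move=> x0 y0 z0 s1; rewrite /Lambda.
have minE (p q r : R) : 0 < p -> 0 < q -> 0 < r -> p^-1 + q^-1 <= r^-1 ->
    r <= p /\ r <= q.
  move=> p0 q0 r0 h; have [pi qi] : 0 < p^-1 /\ 0 < q^-1 by rewrite !invr_gt0.
  by split; rewrite -lef_pV2 ?posrE//; lra.
case: ifPn => [tri|].
  exists (Num.sqrt (threshold_b x y z))^-1; rewrite mulrC.
  by split; rewrite ?invr_ge0 ?sqrtr_ge0//; exact: sharp_acute.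
set m := Num.min _ _ => nt; exists (Num.sqrt ((1 - m) / m)); split => //.
move: nt; rewrite !negb_and -!leNgt => /or3P[] obt.
- have [mx my] := minE _ _ _ x0 y0 z0 obt.
  have -> : m = z by rewrite /m (min_idPr my) (min_idPr mx).
  exact: sharp_obtuse.
- have [my mz] := minE _ _ _ y0 z0 x0 obt.
  have -> : m = x by rewrite /m; apply/min_idPl; rewrite le_min my mz.
  apply/sharp_swap12/sharp_swap23; apply: sharp_obtuse => //.
  by rewrite -s1; ring.
- have [mx mz] := minE _ _ _ x0 z0 y0 obt.
  have -> : m = y by rewrite /m (min_idPl mz) (min_idPr mx).
  apply: sharp_swap23; apply: sharp_obtuse => //.
  by rewrite -s1; ring.
Qed.

End Threshold.

Theorem mainTheorem2 (R : realType) (mu : 'cV[R]_3)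
    (mu_gt0 : forall i : 'I_3, 0 < mu i 0)
    (mu_sum1 : \sum_(i < 3) mu i 0 = 1) (lambda : R) :
  let P := Pinfty mu + lambda *: (1%:M - Pinfty mu) in
  lambda < 0 -> stochastic_mx P ->
  embeddable P <-> Lambda (mu 0 0) (mu 1 0) (mu 2 0) <= lambda < 0.
Proof.
move=> P l0 _; have s1 := mu_sum1; rewrite sum3E in s1.
have [T [T0 [att lb] ->]] := Lambda_sharp (mu_gt0 0) (mu_gt0 1) (mu_gt0 2) s1.
rewrite l0 andbT; split.
  move=> /(embeddable_spectrum mu_gt0 mu_sum1 l0).
  move=> [a [beta [u [v [w [c [[-> pib tr det] [cu cv cw]]]]]]]].
  rewrite lerN2 ler_expR lerN2.
  by apply: le_trans (lb _ _ _ _ _ _ tr det cu cv cw); rewrite ler_wpM2l.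
move=> Tl; pose a := - ln (- lambda).
have lE : lambda = - expR (- a) by rewrite opprK lnK ?opprK// posrE oppr_gt0.
have Ta : T * pi <= a by move: Tl; rewrite lE lerN2 ler_expR lerN2.
have [u [v [w [c [[tr det] [hu hv hw]]]]]] := att.
by rewrite /P lE; exact: (embeddable_rot mu_gt0 mu_sum1 Ta tr det hu hv hw).
Qed.
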